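(* Let $(X_k)_{k\in\mathbb{Z}}$ be a strictly stationary sequence of square-integrable real random variables, standardized so that $E(X_k)=0$ and $E(X_k^2)=1$. Put $r_k=E(X_0X_k)$ and $r=r_1$, and assume $r\neq 0$ and $2|r|<1+r_2$. Suppose that there are a symmetric linear polynomial $L(x,y)=a(x+y)+b$ and a symmetric quadratic polynomial $Q(x,y)=A(x^2+y^2)+Bxy+C+D(x+y)$ with real coefficients such that, for all $k\in\mathbb{Z}$, almost surely $$E(X_k\mid \dots,X_{k-2},X_{k-1},X_{k+1},X_{k+2},\dots)=L(X_{k-1},X_{k+1}),$$ $$E(X_k^2\mid \dots,X_{k-2},X_{k-1},X_{k+1},X_{k+2},\dots)=Q(X_{k-1},X_{k+1}).$$ Suppose moreover that $D=0$ and $$A\left(r^2+\frac{1}{r^2}\right)+B=1.$$ Then either $A\geq \dfrac{1}{1+r^2}$ or $A\leq \dfrac{r^2}{1+r^4}$.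
   Context: $E(\,\cdot\mid \dots,X_{k-2},X_{k-1},X_{k+1},X_{k+2},\dots)$ denotes the conditional expectation with respect to the sigma-field generated by $\{X_j: j\neq k\}$. Equalities of conditional expectations are understood almost surely. *)

(* Defs.v *)
From HB Require Import structures.
From mathcomp Require Import all_boot all_order all_algebra.
From mathcomp Require Import all_classical all_reals all_analysis.

Set Implicit Arguments.
Unset Strict Implicit.
Unset Printing Implicit Defensive.

Import Order.TTheory GRing.Theory Num.Theory.
Import numFieldNormedType.Exports.

Local Open Scope classical_set_scope.
Local Open Scope ring_scope.

Section process.
Context {d : measure_display} {T : measurableType d} {R : realType}
  (P : probability T R).

(* All finite-dimensional joint laws, as measures on the product sigma-algebra
   of n.-tuple R, are invariant under time shifts. *)
Definition strictly_stationary (X : int -> {RV P >-> R}) : Prop :=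
  forall (n : nat) (t : 'I_n -> int) (h : int) (B : set (n.-tuple R)),
    measurable B ->
    pushforward P (fun w => [tuple X (t i + h) w | i < n]) B
    = pushforward P (fun w => [tuple X (t i) w | i < n]) B.

Definition sigma_others (X : int -> {RV P >-> R}) (k : int) : set_system T :=
  <<s \bigcup_(j in [set j : int | j <> k]) g_sigma_algebra_preimage (X j) >>.

(* Z is a version of E(Y | F), for an integrable Y and a sigma-algebra F
   contained in the measurable sets of T. *)
Definition is_cond_expectation (F : set_system T) (Y Z : T -> R) : Prop :=
  [/\ forall B : set R, measurable B -> F (Z @^-1` B),
      P.-integrable [set: T] (EFin \o Z)
    & forall A : set T, F A ->
        (\int[P]_(w in A) (Z w)%:E = \int[P]_(w in A) (Y w)%:E)%E].

(* E(Y | F) = W almost surely. *)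
Definition cond_expectation_ae_eq (F : set_system T) (Y W : T -> R) : Prop :=
  exists Z : T -> R,
    is_cond_expectation F Y Z /\ {ae P, forall w, Z w = W w}.

End process.

(* Main.v *)
Require Import Defs.
From HB Require Import structures.
From mathcomp Require Import all_boot all_order all_algebra.
From mathcomp Require Import all_classical all_reals all_analysis.
From mathcomp Require Import measurable_realfun ring lra zify.
Import Order.TTheory GRing.Theory Num.Theory.
Import numFieldNormedType.Exports.
Local Open Scope classical_set_scope.
Local Open Scope ring_scope.

(** Suppose that A lies strictly between r^2/(1+r^4) and 1/(1+r^2).  The two
regression hypotheses then determine so many mixed moments of X_0, X_1, X_2
that the fourth moment M = E X_k^4 can be computed, and it comes out smaller
than 1; this contradicts M >= (E X_k^2)^2 = 1.

Linear part ([regression]).  Fix a test variable g depending on the past of k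
only.  The numbers m_n = E(X_{k+n} g) solve m_{n+1} = a (m_n + m_{n+2}) and
are bounded.  Since r = a (1 + r_2), the assumption 2|r| < 1 + r_2 says
|a| < 1/2, and then a bounded solution is determined by m_0
([bounded_harmonic_eq0]).  The covariances r_n are one such solution, so
m_n = m_0 r_n; for n = 1 this is E(X_{k+1} | past) = r X_k.  Consequently
r_2 = r^2, a = r/(1+r^2) and |r| < 1.  The hypotheses do not distinguish past
from future, so everything holds in both directions of time.

Quadratic part ([sq_regression]).  For a bounded g depending on the past of k,
put u_i = E(X_{k+i}^2 g).  Computing E(X_{k+1} X_{k+2} g) both by the one-sided
and by the two-sided linear regression gives u_2 = (1+r^2) u_1 - r^2 u_0, and
the two-sided quadratic regression is a second relation between u_0, u_1, u_2.
Eliminating u_2 leaves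
(1 - A(1+r^2)) (u_1 - r^2 u_0 - (1-r^2) E g) = 0, whose first factor is not
zero, that is, E(X_{k+1}^2 | past) = r^2 X_k^2 + 1 - r^2.

Finite fourth moment ([X4_L1]).  The residuals U = X_{k+1} - r X_k and
V = X_k - r X_{k+1} have the constant conditional variance 1 - r^2 given X_k,
respectively given X_{k+1}.  A large X_k forces U to be large, or else X_{k+1}
is comparable to X_k and one of U and V is large; hence a truncated version of
X_k^4 is dominated by U^2 and V^2 weighted by truncations of X_k^2 and
X_{k+1}^2, and the expectation of the latter is bounded uniformly in the
truncation.

Fourth moments ([no_intermediate_coefficient]).  Two one-sided regressions give
E(X_0 X_1^2 X_2) = r^2 M; the quadratic regression expresses the same number by
A, B, C and M.  The result is r^2 C (M - 1) = B (1 - r^4), where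
C = (1-r^2)(1 - A(1+r^2)) > 0 and r^2 B = r^2 - A(1+r^4) < 0. *)

(** * Integrals against test functions *)

Section integral_facts.
Context {d : measure_display} {T : measurableType d} {R : realType}
  (P : probability T R).
Implicit Types (f g h Y W : T -> R).

Local Notation L1 f := (P.-integrable [set: T] (EFin \o f)).

Lemma L1_measurable {f} : L1 f -> measurable_fun setT f.
Proof. by move=> /(measurable_int P)/measurable_EFinP. Qed.

Lemma L1_dominated {f} h : measurable_fun setT f -> L1 h ->
  (forall w, `|f w| <= h w) -> L1 f.
Proof.
move=> mf ih fh; apply: le_integrable ih => //; first exact/measurable_EFinP.
by move=> w _ /=; rewrite lee_fin (le_trans (fh w))// ler_norm.
Qed.

Lemma L1_lincomb2 (c1 c2 : R) {f1 f2} f : L1 f1 -> L1 f2 ->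
  (forall w, f w = c1 * f1 w + c2 * f2 w) ->
  L1 f /\ \int[P]_w f w = c1 * (\int[P]_w f1 w) + c2 * (\int[P]_w f2 w).
Proof.
move=> i1 i2 fE; have -> : f = (fun w => c1 * f1 w + c2 * f2 w) by exact/funext.
have I1 : L1 (fun w => c1 * f1 w) by exact: (integrableZl measurableT c1 i1).
have I2 : L1 (fun w => c2 * f2 w) by exact: (integrableZl measurableT c2 i2).
split; first exact: integrableD I1 I2.
by rewrite RintegralD// !RintegralZl.
Qed.

Lemma L1_lincomb4 (c1 c2 c3 c4 : R) {f1 f2 f3 f4} f :
  L1 f1 -> L1 f2 -> L1 f3 -> L1 f4 ->
  (forall w, f w = c1 * f1 w + c2 * f2 w + c3 * f3 w + c4 * f4 w) ->
  L1 f /\ \int[P]_w f w = c1 * (\int[P]_w f1 w) + c2 * (\int[P]_w f2 w)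
                          + c3 * (\int[P]_w f3 w) + c4 * (\int[P]_w f4 w).
Proof.
move=> i1 i2 i3 i4 fE.
have [I12 E12] := L1_lincomb2 c1 c2 _ i1 i2 (fun w => erefl).
have [I34 E34] := L1_lincomb2 c3 c4 _ i3 i4 (fun w => erefl).
have [I E] := L1_lincomb2 1 1 f I12 I34
  (fun w => ltac:(rewrite fE; ring)).
by split => //; rewrite E E12 E34; ring.
Qed.

Lemma L1_cst (c : R) : L1 (fun=> c).
Proof. exact: finite_measure_integrable_cst. Qed.

Lemma Rintegral_prob_cst (c : R) : \int[P]_(_ in [set: T]) c = c.
Proof.
have P1 : fine (P setT) = 1 by rewrite probability_setT.
by rewrite Rintegral_cst//; exact: (etrans (congr1 ( *%R c) P1) (mulr1 c)).
Qed.

Lemma L1_mul_bounded {f g} (K : R) : L1 f -> measurable_fun setT g ->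
  (forall w, `|g w| <= K) -> L1 (fun w => f w * g w).
Proof.
move=> If mg gK.
have IK : L1 (fun w => K * `|f w|).
  exact: (integrableZl measurableT K (integrable_norm If)).
apply: L1_dominated IK _.
  by apply: measurable_funM => //; exact: L1_measurable.
by move=> w; rewrite normrM mulrC ler_wpM2r.
Qed.

Lemma L1_mul_indic {f A} : L1 f -> measurable A -> L1 (fun w => f w * \1_A w).
Proof.
move=> If mA; apply: (L1_mul_bounded 1) => //.
by move=> w; rewrite indicE; case: (_ \in _); rewrite /= ?normr1 ?normr0.
Qed.

Lemma Rintegral_indic f A :
  \int[P]_(w in A) f w = \int[P]_w (f w * \1_A w).
Proof. by rewrite Rintegral_mkcond patch_indic. Qed.

Lemma L1_sum {I : Type} (s : seq I) {f : I -> T -> R} :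
  (forall i, L1 (f i)) -> (forall i, \int[P]_w f i w = 0) ->
  L1 (fun w => \sum_(i <- s) f i w) /\ \int[P]_w (\sum_(i <- s) f i w) = 0.
Proof.
move=> If f0; elim: s => [|i s [Is s0]].
  have -> : (fun w => \sum_(i <- [::]) f i w) = (fun=> 0).
    by apply/funext => w; rewrite big_nil.
  by split; [exact: L1_cst|exact: Rintegral_prob_cst].
have [] := L1_lincomb2 1 1 (fun w => \sum_(i <- i :: s) f i w) (If i) Is.
  by move=> w; rewrite big_cons !mul1r.
by move=> ? ->; split => //; rewrite f0 s0; ring.
Qed.

Import HBSimple HBNNSimple.
Section sub_sigma_algebra.
Context {G : set_system T} (Gm : G `<=` measurable).

Lemma gen_measurable {A : set T} : <<s G >> A -> measurable A.
Proof.
by apply: smallest_sub; [exact: sigma_algebra_measurable|exact: Gm].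
Qed.

Lemma gen_measurable_fun {g} :
  measurable_fun (setT : set (g_sigma_algebraType G)) g ->
  measurable_fun (setT : set T) g.
Proof. by move=> mg _ B mB; apply: gen_measurable; exact: mg. Qed.

(** On indicators this is the hypothesis, and g is an increasing limit of
simple functions that are themselves measurable for the generated
sigma-algebra; dominated convergence with bound |D g| passes to the limit. *)
Let Rintegral_nneg_test_function_eq0 (D g : T -> R) :
  L1 D -> (forall A, <<s G >> A -> \int[P]_(w in A) D w = 0) ->
  measurable_fun (setT : set (g_sigma_algebraType G)) g ->
  (forall w, 0 <= g w) -> L1 (fun w => D w * g w) ->
  \int[P]_w (D w * g w) = 0.
Proof.
move=> iD D0 mg g0 iDg.
have mg' : measurable_fun (setT : set (g_sigma_algebraType G)) (EFin \o g).
  exact/measurable_EFinP.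
pose h := nnsfun_approx measurableT mg'.
have hg w : (fun n => h n w) @ \oo --> g w.
  have := @cvg_nnsfun_approx _ _ _ _ measurableT _ mg' (fun w _ => g0 w) w I.
  by move/fine_cvgP => -[].
have hleg n w : h n w <= g w.
  have nd := @nd_nnsfun_approx _ _ _ _ measurableT _ mg'.
  rewrite -(cvg_lim _ (hg w))//.
  apply: (@nondecreasing_cvgn_le _ (fun n => h n w)).
    by move=> m k mk; have /lefP := nd _ _ mk; exact.
  by apply/cvg_ex; exists (g w).
have Dh n : L1 (fun w => D w * h n w) /\ \int[P]_w (D w * h n w) = 0.
  pose s : seq R := finmap.enum_fset (fset_set (range (h n))).
  pose L (y : R) : set T := h n @^-1` [set y].
  pose f (y : R) (w : T) := D w * (y * \1_(L y) w).
  have GA (y : R) : <<s G >> (L y).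
    rewrite -[X in <<s _ >> X]setTI.
    exact: (@measurable_funPT _ _ _ _ (h n)).
  have mA y := gen_measurable (GA y).
  have If y : L1 (f y).
    apply: (L1_mul_bounded `|y|) => //.
      by apply: measurable_funM => //; exact: measurable_indic.
    move=> w; rewrite indicE.
    by case: (_ \in _) => /=; rewrite ?mulr1 ?mulr0 ?normr0.
  have f0 y : \int[P]_w f y w = 0.
    have -> : f y = (fun w => y * (D w * \1_(L y) w)).
      by apply/funext => w; rewrite /f; ring.
    rewrite RintegralZl//; last exact: L1_mul_indic.
    by rewrite -Rintegral_indic// D0// mulr0.
  have [] := L1_sum s If f0.
  suff -> : (fun w => \sum_(i <- s) f i w) = (fun w => D w * h n w) by [].
  apply/funext => w; rewrite [in RHS](fimfunE (h n)) fsbig_finite//=.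
  by rewrite mulr_sumr.
have cDhg w : (D w * h n w)%:E @[n --> \oo] --> (D w * g w)%:E.
  apply: cvg_EFin; first exact: nearW.
  exact: cvgMl_tmp (hg w).
have mDg : measurable_fun setT (EFin \o (fun w => D w * g w)).
  exact: measurable_int iDg.
have [|||_ _ cv] := @dominated_convergence _ _ _ P setT measurableT
  (fun n w => (D w * h n w)%:E) (fun w => (D w * g w)%:E)
  (fun w => `|D w * g w|%:E) (fun n => measurable_int _ (Dh n).1) mDg.
- exact: aeW.
- exact: integrable_norm.
- apply: aeW => w n _; rewrite lee_fin !normrM ler_wpM2l//.
  by rewrite !ger0_norm//; exact: fun_ge0.
rewrite /Rintegral.
rewrite -(cvg_lim _ cv)//.
rewrite (_ : (fun _ => _) = fun=> 0%E) ?lim_cst//.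
apply/funext => n; have [IDh] := Dh n; rewrite /Rintegral => /eqP.
by rewrite -eqe fineK ?integrable_fin_num// => /eqP.
Qed.

(** The defining identity of a conditional expectation concerns events only.
This is its extension to test functions g that may be unbounded, as long as
the two products are integrable. *)
Lemma eq_Rintegral_test_function Y W g :
  L1 Y -> L1 W ->
  (forall A, <<s G >> A -> \int[P]_(w in A) Y w = \int[P]_(w in A) W w) ->
  measurable_fun (setT : set (g_sigma_algebraType G)) g ->
  L1 (fun w => Y w * g w) -> L1 (fun w => W w * g w) ->
  \int[P]_w (Y w * g w) = \int[P]_w (W w * g w).
Proof.
move=> IY IW YW mg IYg IWg.
have [|ID _] := L1_lincomb2 1 (-1) (fun w => Y w - W w) IY IW.
  by move=> w; ring.
have D0 A : <<s G >> A -> \int[P]_(w in A) (Y w - W w) = 0.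
  move=> GA; have mA := gen_measurable GA.
  have sub f : L1 f -> P.-integrable A (EFin \o f).
    by move=> If; apply: integrableS If.
  by rewrite RintegralB ?YW ?subrr//; exact: sub.
have [|IDg EDg] := L1_lincomb2 1 (-1) (fun w => (Y w - W w) * g w) IYg IWg.
  by move=> w; ring.
pose p w := Num.max (g w) 0; pose m w := Num.max (- g w) 0.
have gE w : g w = p w - m w.
  by rewrite /p /m !maxEle; case: ifP; case: ifP; lra.
have mp : measurable_fun (setT : set (g_sigma_algebraType G)) p.
  exact: measurable_maxr.
have mm : measurable_fun (setT : set (g_sigma_algebraType G)) m.
  by apply: measurable_maxr => //; exact: measurable_funN.
have p0 w : 0 <= p w by rewrite /p le_max lexx orbT.
have m0 w : 0 <= m w by rewrite /m le_max lexx orbT.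
have part (q : T -> R) :
    measurable_fun (setT : set (g_sigma_algebraType G)) q ->
    (forall w, 0 <= q w) -> (forall w, q w <= `|g w|) ->
    L1 (fun w => (Y w - W w) * q w) /\ \int[P]_w ((Y w - W w) * q w) = 0.
  move=> mq q0 qg; have Iq : L1 (fun w => (Y w - W w) * q w).
    apply: (L1_dominated (fun w => `|(Y w - W w) * g w|)).
    - apply: measurable_funM; first exact: L1_measurable.
      exact: gen_measurable_fun.
    - exact: integrable_norm.
    - by move=> w; rewrite !normrM (ger0_norm (q0 w)) ler_wpM2l.
  by split => //; exact: Rintegral_nneg_test_function_eq0.
have [Ip Ep] := part p mp p0
  (fun w => ltac:(rewrite /p ge_max ler_norm normr_ge0//)).
have [Im Em] := part m mm m0
  (fun w => ltac:(rewrite /m ge_max -normrN ler_norm normr_ge0//)).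
have [|_] := L1_lincomb2 1 (-1) (fun w => (Y w - W w) * g w) Ip Im.
  by move=> w; rewrite gE; ring.
by rewrite EDg Ep Em => E; apply/eqP; rewrite -subr_eq0; apply/eqP; lra.
Qed.

End sub_sigma_algebra.
End integral_facts.

(** * Two facts about real numbers *)

(** A bound K for |m| improves to 2|a|K after one use of the recursion, hence
to (2|a|)^j K for every j. *)
Lemma bounded_harmonic_eq0 {R : realType} (a K : R) (m : nat -> R) :
  2 * `|a| < 1 -> m 0%N = 0 -> (forall n, `|m n| <= K) ->
  (forall n, m n.+1 = a * (m n + m n.+2)) -> forall n, m n = 0.
Proof.
move=> a1 m0 mK mrec.
set t := 2 * `|a| in a1.
have t0 : 0 <= t by rewrite mulr_ge0.
have K0 : 0 <= K by apply: le_trans (mK 0%N).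
have bnd j : forall n, `|m n| <= t ^+ j * K.
  elim: j => [|j IH] [|n].
  - by rewrite mul1r.
  - by rewrite mul1r.
  - by rewrite m0 normr0 mulr_ge0// exprn_ge0.
  - rewrite mrec normrM exprS.
    have H : `|m n + m n.+2| <= 2 * (t ^+ j * K).
      by rewrite (le_trans (ler_normD _ _))// mulr2n mulrDl mul1r lerD.
    by apply: le_trans (ler_wpM2l (normr_ge0 a) H) _; rewrite /t; lra.
move=> n; apply/eqP; rewrite -normr_eq0 eq_le normr_ge0 andbT.
have cv : (t ^+ j * K) @[j --> \oo] --> 0 * K.
  by apply: cvgMr_tmp; apply: cvg_expr; rewrite ger0_norm.
rewrite mul0r in cv.
rewrite -(cvg_lim _ cv)//; apply: limr_ge; first by apply/cvg_ex; exists 0.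
exact: nearW.
Qed.

Definition trunc_sq {R : realType} (n : nat) (x : R) : R :=
  Num.min (x ^+ 2) n%:R.

Lemma trunc_sq_ge0 {R : realType} n (x : R) : 0 <= trunc_sq n x.
Proof. by rewrite /trunc_sq le_min sqr_ge0 ler0n. Qed.

(** In the application x and y are two neighbours X_k and X_{k+1}, and y - r x
and x - r y are their regression residuals.  If 2|y| < |r x|, then y - r x
alone is of the size of x.  Otherwise x is a combination of the two residuals,
and the weight at x is at most 4/r^2 times the weight at y.  Each residual thus
comes with a weight that depends only on the variable conditioned upon. *)
Lemma trunc_sq_step {R : realType} (r : R) n (x y : R) : r ^+ 2 < 1 ->
  r ^+ 2 * (1 - r ^+ 2) ^+ 2 * (x * x * trunc_sq n x)
  <= 8 * ((y - r * x) ^+ 2 * trunc_sq n x)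
     + 8 * ((x - r * y) ^+ 2 * trunc_sq n y).
Proof.
move=> r_lt1.
have px := trunc_sq_ge0 n x; have py := trunc_sq_ge0 n y.
have r2 : 0 <= r ^+ 2 by exact: sqr_ge0.
set p := trunc_sq n x in px *; set q := trunc_sq n y in py *.
set U2 := (y - r * x) ^+ 2; set V2 := (x - r * y) ^+ 2.
have U0 : 0 <= U2 by exact: sqr_ge0.
have V0 : 0 <= V2 by exact: sqr_ge0.
have Uq : 0 <= U2 * p by exact: mulr_ge0.
have Vq : 0 <= V2 * q by exact: mulr_ge0.
have [near_|far] := leP (r ^+ 2 * x ^+ 2) (4 * y ^+ 2).
- have pq : r ^+ 2 * p <= 4 * q.
    rewrite /p /q /trunc_sq; set m := (n%:R : R).
    have m0 : 0 <= m by exact: ler0n.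
    have : Num.min (x ^+ 2) m <= x ^+ 2 by rewrite ge_min lexx.
    have : Num.min (x ^+ 2) m <= m by rewrite ge_min lexx orbT.
    move: (Num.min _ _) => z z2 z1.
    have h1 := ler_wpM2l r2 z1; have h2 := ler_wpM2l r2 z2.
    have h3 : r ^+ 2 * m <= m by rewrite ler_piMl// ltW.
    by case: (leP (y ^+ 2) m) => _; lra.
  have UV : (1 - r ^+ 2) ^+ 2 * (x * x) <= 2 * V2 + 2 * (r ^+ 2 * U2).
    (* (1 - r^2) x is the sum of x - r y and r (y - r x) *)
    rewrite -subr_ge0.
    rewrite (_ : _ - _ = ((x - r * y) - r * (y - r * x)) ^+ 2) ?sqr_ge0//.
    by rewrite /U2 /V2; ring.
  have H1 : r ^+ 2 * p * ((1 - r ^+ 2) ^+ 2 * (x * x)) <=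
      r ^+ 2 * p * (2 * V2 + 2 * (r ^+ 2 * U2)) by rewrite ler_wpM2l// mulr_ge0.
  have H2 : r ^+ 2 * p * V2 <= 4 * q * V2 by rewrite ler_wpM2r.
  have H3 : r ^+ 2 * r ^+ 2 * (U2 * p) <= 1 * (U2 * p).
    by rewrite ler_wpM2r// mulr_ile1// ltW.
  by move: H1 H2 H3 Uq Vq; lra.
- have xU : r ^+ 2 * (x * x) <= 4 * U2.
    have yx : 2 * `|y| <= `|r * x|.
      rewrite -[2]ger0_norm// -normrM -ler_sqr ?nnegrE//.
      rewrite !real_normK ?num_real//.
      by rewrite !exprMn; move: far; lra.
    have : `|r * x| <= 2 * `|y - r * x|.
      by have := ler_normB y (y - r * x); rewrite subKr; move: yx; lra.
    rewrite -ler_sqr ?nnegrE// ?mulr_ge0// exprMn !real_normK ?num_real//.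
    by rewrite /U2; lra.
  have H1 : (1 - r ^+ 2) ^+ 2 * p * (r ^+ 2 * (x * x))
      <= (1 - r ^+ 2) ^+ 2 * p * (4 * U2).
    by rewrite ler_wpM2l// mulr_ge0// sqr_ge0.
  have H2 : (1 - r ^+ 2) ^+ 2 * (U2 * p) <= 1 * (U2 * p).
    by rewrite ler_wpM2r// expr_le1//; move: r2 r_lt1; lra.
  by move: H1 H2 Uq Vq; lra.
Qed.

(** * Random variables determined by part of the process *)

Section adapted.
Context {d : measure_display} {T : measurableType d} {R : realType}
  {P : probability T R}.
Context (X : int -> {RV P >-> R}).

Definition gens (J : set int) : set_system T :=
  \bigcup_(j in J) g_sigma_algebra_preimage (X j).

Definition adapted (J : set int) (g : T -> R) : Prop :=
  measurable_fun (setT : set (g_sigma_algebraType (gens J))) g.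

Lemma gens_measurable J : gens J `<=` measurable.
Proof.
move=> A [j _ [B mB <-]]; rewrite setTI.
exact: measurable_funPTI.
Qed.

Lemma adapted_measurable {J g} : adapted J g -> measurable_fun setT g.
Proof. exact: (gen_measurable_fun (gens_measurable J)). Qed.

Lemma adapted_X (J : set int) j : J j -> adapted J (X j).
Proof.
move=> Jj _ B mB; apply: sub_sigma_algebra; exists j => //.
by exists B.
Qed.

Lemma adaptedM J g h : adapted J g -> adapted J h ->
  adapted J (fun w => g w * h w).
Proof. exact: measurable_funM. Qed.

Lemma adapted_sub (J J' : set int) g : J `<=` J' -> adapted J g -> adapted J' g.
Proof.
move=> JJ' ag _ B mB; have := ag measurableT B mB.
by apply: sub_sigma_algebra2; exact: bigcup_subset.
Qed.

Lemma adapted_indic J (A : set T) : <<s gens J >> A -> adapted J \1_A.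
Proof.
move=> GA.
exact: (@measurable_indic _ (g_sigma_algebraType (gens J)) R setT A GA).
Qed.

End adapted.

(** The past of k for s = 1 and its future for s = -1.  Carrying the direction
s along treats both at once. *)
Definition behind (s k : int) : set int := [set j | s * j <= s * k].
Definition others (k : int) : set int := [set j | j <> k].
Definition direction (s : int) : Prop := s = 1 \/ s = -1.

Lemma behind_others s k (n : nat) : direction s ->
  behind s k `<=` others (k + s * n.+1%:Z).
Proof. by rewrite /behind /others => -[] -> j /=; lia. Qed.

Lemma behind_step s k : direction s -> behind s k `<=` behind s (k + s).
Proof. by rewrite /behind => -[] -> j /=; lia. Qed.

(** * One-sided linear regression *)

Section two_sided_regressions.
Context {d : measure_display} {T : measurableType d} {R : realType}
  {P : probability T R} (X : int -> {RV P >-> R}).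
Local Notation L1 f := (P.-integrable [set: T] (EFin \o f)).
Local Notation adapted := (adapted X).
Local Notation gens := (gens X).

Context (r a b : R)
  (X2 : forall k, L1 (fun w => X k w ^+ 2))
  (EX : forall k, \int[P]_w X k w = 0)
  (EX2 : forall k, \int[P]_w (X k w ^+ 2) = 1)
  (rE : \int[P]_w (X 1 w * X 0 w) = r)
  (hr2 : 2 * `|r| < 1 + \int[P]_w (X 2 w * X 0 w))
  (hlin : forall k (S : set T), <<s gens (others k) >> S ->
     \int[P]_(w in S) X k w
     = \int[P]_(w in S) (a * (X (k - 1) w + X (k + 1) w) + b)).

Lemma X_L1 k : L1 (X k).
Proof.
have [|I _] := L1_lincomb2 P 1 1 (fun w => X k w ^+ 2 + 1) (X2 k) (L1_cst P 1).
  by move=> w; rewrite !mul1r.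
apply: (L1_dominated P _ _ I) => // w.
rewrite ler_norml; have := sqr_ge0 (X k w - 1); have := sqr_ge0 (X k w + 1).
by rewrite !expr2 => ? ?; apply/andP; split; lra.
Qed.

Lemma XX_L1 j k : L1 (fun w => X j w * X k w).
Proof.
have [|I _] := L1_lincomb2 P 1 1 (fun w => X j w ^+ 2 + X k w ^+ 2)
  (X2 j) (X2 k).
  by move=> w; rewrite !mul1r.
apply: (L1_dominated P _ _ I) => [|w]; first exact: measurable_funM.
rewrite ler_norml; have := sqr_ge0 (X j w - X k w).
have := sqr_ge0 (X j w + X k w).
by rewrite !expr2 => ? ?; apply/andP; split; nra.
Qed.

Lemma XX_le1 j k : `|\int[P]_w (X j w * X k w)| <= 1.
Proof.
have [|I E] := L1_lincomb2 P 2^-1 2^-1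
  (fun w => (X j w ^+ 2 + X k w ^+ 2) / 2) (X2 j) (X2 k).
  by move=> w; lra.
apply: le_trans (le_normr_Rintegral measurableT (XX_L1 j k)) _.
have -> : 1 = \int[P]_w ((X j w ^+ 2 + X k w ^+ 2) / 2) by rewrite E !EX2; lra.
apply: le_Rintegral => // [|w _]; first exact: integrable_norm (XX_L1 j k).
rewrite ler_norml; have := sqr_ge0 (X j w - X k w).
have := sqr_ge0 (X j w + X k w).
by rewrite !expr2 => ? ?; apply/andP; split; nra.
Qed.

Lemma Xbounded_le k (g : T -> R) : measurable_fun setT g ->
  (forall w, `|g w| <= 1) -> `|\int[P]_w (X k w * g w)| <= 1.
Proof.
move=> mg g1.
have I := L1_mul_bounded P 1 (X_L1 k) mg g1.
have [|I2 E2] := L1_lincomb2 P 2^-1 2^-1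
  (fun w => (X k w ^+ 2 + 1) / 2) (X2 k) (L1_cst P 1).
  by move=> w; lra.
apply: le_trans (le_normr_Rintegral measurableT I) _.
have -> : 1 = \int[P]_w ((X k w ^+ 2 + 1) / 2).
  by rewrite E2 EX2 Rintegral_prob_cst; lra.
apply: le_Rintegral => // [|w _]; first exact: integrable_norm I.
rewrite normrM; apply: le_trans (ler_wpM2l _ (g1 w)) _ => //; rewrite mulr1.
rewrite ler_norml; have := sqr_ge0 (X k w - 1); have := sqr_ge0 (X k w + 1).
by rewrite !expr2 => ? ?; apply/andP; split; lra.
Qed.

Lemma b_eq0 : b = 0.
Proof.
have := hlin 0 setT; rewrite EX => H.
have [|I E] := L1_lincomb4 P a a b 0
  (fun w => a * (X (0 - 1) w + X (0 + 1) w) + b)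
  (X_L1 (0 - 1)) (X_L1 (0 + 1)) (L1_cst P 1) (L1_cst P 1).
  by move=> w; ring.
have := H (@measurableT _ (g_sigma_algebraType (gens (others 0)))).
by rewrite E !EX !Rintegral_prob_cst; lra.
Qed.

(** The integrands are passed as separate functions with pointwise equations,
so that an application may choose the order of the factors. *)
Lemma lin_test s k g (F0 F1 F2 : T -> R) :
  direction s -> adapted (others k) g ->
  L1 F0 -> L1 F1 -> L1 F2 ->
  (forall w, F0 w = X (k - s) w * g w) ->
  (forall w, F1 w = X k w * g w) ->
  (forall w, F2 w = X (k + s) w * g w) ->
  \int[P]_w F1 w = a * (\int[P]_w F0 w + \int[P]_w F2 w).
Proof.
move=> ds ag I0 I1 I2 /funext E0 /funext E1 /funext E2; subst F0 F1 F2.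
have [|IW _] := L1_lincomb2 P a a
  (fun w => a * (X (k - 1) w + X (k + 1) w) + b) (X_L1 (k - 1)) (X_L1 (k + 1)).
  by move=> w; rewrite b_eq0; ring.
have [|IWg EWg] := L1_lincomb2 P a a
  (fun w => (a * (X (k - 1) w + X (k + 1) w) + b) * g w) I0 I2.
  by case: ds => -> w; rewrite b_eq0 ?opprK; ring.
rewrite (eq_Rintegral_test_function P (@gens_measurable _ _ _ _ X _) _ _ _
  (X_L1 k) IW (hlin k) ag I1 IWg) EWg.
by ring.
Qed.

Lemma r_eq : r = a * (1 + \int[P]_w (X 2 w * X 0 w)).
Proof.
rewrite -rE (@lin_test 1 1 (X 0) (fun w => X 0 w ^+ 2) _
  (fun w => X 2 w * X 0 w)) ?EX2 //; try exact: XX_L1.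
- by left.
- exact: adapted_X.
Qed.

(** This is how the assumption 2|r| < 1 + r_2 enters: it makes the recursion
m_{n+1} = a (m_n + m_{n+2}) have at most one bounded solution with given m_0. *)
Lemma a_lt : 2 * `|a| < 1.
Proof.
have := hr2; rewrite {1}r_eq normrM.
set t := 1 + _ => H.
have t0 : 0 < t by apply: le_lt_trans H; rewrite !mulr_ge0.
by move: H; rewrite (gtr0_norm t0) mulrA -{2}[t]mul1r ltr_pM2r.
Qed.

(** Both E(X_{k+sn} g) and the covariances E(X_n X_0) are bounded solutions of
the same recursion, hence proportional. *)
Lemma regression_step s k g (K : R) : direction s -> adapted (behind s k) g ->
  (forall n : nat, L1 (fun w => X (k + s * n%:Z) w * g w)) ->
  (forall n : nat, `|\int[P]_w (X (k + s * n%:Z) w * g w)| <= K) ->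
  \int[P]_w (X (k + s) w * g w) = r * \int[P]_w (X k w * g w).
Proof.
move=> ds ag I bnd.
pose m n := \int[P]_w (X (k + s * n%:Z) w * g w).
pose rho (n : nat) := \int[P]_w (X n%:Z w * X 0 w).
have mrec n : m n.+1 = a * (m n + m n.+2).
  apply: (@lin_test s (k + s * n.+1%:Z) g) => // w.
  - exact: (adapted_sub X _ _ _ (behind_others s k n ds) ag).
  - by congr (X _ w * _); lia.
  - by congr (X _ w * _); lia.
have rrec n : rho n.+1 = a * (rho n + rho n.+2).
  apply: (@lin_test 1 n.+1%:Z (X 0)); try exact: XX_L1.
  - by left.
  - exact: adapted_X.
  - by move=> w; congr (X _ w * _); lia.
  - by [].
  - by move=> w; congr (X _ w * _); lia.
have rho0 : rho 0%N = 1 by rewrite -(EX2 0).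
have diff0 : m 0%N - m 0%N * rho 0%N = 0 by rewrite rho0 mulr1 subrr.
have diff_le n : `|m n - m 0%N * rho n| <= K + `|m 0%N|.
  rewrite (le_trans (ler_normB _ _))// lerD//; first exact: bnd.
  by rewrite normrM ler_piMr//; exact: XX_le1.
have diff_rec n : m n.+1 - m 0%N * rho n.+1
    = a * (m n - m 0%N * rho n + (m n.+2 - m 0%N * rho n.+2)).
  by rewrite mrec rrec; ring.
have := @bounded_harmonic_eq0 R a _ (fun n => m n - m 0%N * rho n)
  a_lt diff0 diff_le diff_rec 1%N.
have -> : rho 1%N = r by exact: rE.
have -> : m 1%N = \int[P]_w (X (k + s) w * g w) by rewrite /m mulr1.
have -> : m 0%N = \int[P]_w (X k w * g w) by rewrite /m mulr0 addr0.
by move=> /eqP; rewrite subr_eq0 mulrC => /eqP.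
Qed.

(** That is, E(X_{k+s} | X_j, j behind k) = r X_k.  On events it is
[regression_step], since E|X_j| <= 1 bounds the moments against an indicator;
test functions such as X_k^3 are then reached by approximation. *)
Lemma regression s k g (F0 F1 : T -> R) :
  direction s -> adapted (behind s k) g ->
  L1 F0 -> L1 F1 ->
  (forall w, F0 w = X k w * g w) ->
  (forall w, F1 w = X (k + s) w * g w) ->
  \int[P]_w F1 w = r * \int[P]_w F0 w.
Proof.
move=> ds ag I0 I1 /funext E0 /funext E1; subst F0 F1.
have Ir : L1 (fun w => r * X k w).
  exact: (integrableZl measurableT r (X_L1 k)).
have Irg : L1 (fun w => r * X k w * g w).
  have -> : (fun w => r * X k w * g w) = (fun w => r * (X k w * g w)).
    by apply/funext => w; rewrite mulrA.
  exact: (integrableZl measurableT r I0).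
rewrite (eq_Rintegral_test_function P (@gens_measurable _ _ _ _ X _) _ _ _
  (X_L1 (k + s)) Ir _ ag I1 Irg).
  by rewrite -RintegralZl//; congr Rintegral; apply/funext => w; rewrite mulrA.
move=> S GS.
have aS := adapted_indic X _ _ GS.
have mS := adapted_measurable X aS.
have S1 w : `|\1_S w| <= 1 :> R.
  by rewrite indicE; case: (_ \in _); rewrite /= ?normr1 ?normr0.
have I k' : L1 (fun w => X k' w * \1_S w).
  exact: (L1_mul_bounded P 1 (X_L1 k') mS S1).
rewrite (Rintegral_indic P (X (k + s)) S) (Rintegral_indic P _ S).
rewrite (regression_step s k \1_S 1 ds aS (fun n => I _)
  (fun n => Xbounded_le _ _ mS S1)).
rewrite -(RintegralZl r measurableT (I k)).
by congr Rintegral; apply/funext => w; rewrite mulrA.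
Qed.

Lemma cov1 s k : direction s -> \int[P]_w (X (k + s) w * X k w) = r.
Proof.
move=> ds; rewrite (@regression s k (X k) (fun w => X k w ^+ 2))//.
- by rewrite EX2 mulr1.
- by apply: adapted_X; rewrite /behind /=.
- exact: XX_L1.
Qed.

Lemma cov2 s k : direction s -> \int[P]_w (X (k + s + s) w * X k w) = r ^+ 2.
Proof.
move=> ds.
rewrite (@regression s (k + s) (X k) (fun w => X (k + s) w * X k w))//.
- by rewrite cov1// expr2.
- by apply: adapted_X; apply: (behind_step s k ds); rewrite /behind /=.
- exact: XX_L1.
- exact: XX_L1.
Qed.

Let cov02 : \int[P]_w (X 2 w * X 0 w) = r ^+ 2.
Proof. exact: (cov2 1 0 (or_introl erefl)). Qed.

Lemma a_eq : a * (1 + r ^+ 2) = r.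
Proof. by rewrite [RHS]r_eq cov02. Qed.

(** Cauchy-Schwarz gives |r| <= 1, and |r| = 1 would turn 2|r| < 1 + r^2 into
2 < 2. *)
Lemma r_lt1 : r ^+ 2 < 1.
Proof.
have r1 : `|r| <= 1 by rewrite -(cov1 1 0 (or_introl erefl)); exact: XX_le1.
have := hr2; rewrite cov02 -(real_normK (num_real r)) => H.
rewrite expr_lt1// lt_neqAle r1 andbT; apply/eqP => r_1.
by move: H; rewrite r_1; lra.
Qed.

(** * One-sided quadratic regression *)

Context (A B C : R) (r_neq0 : r != 0)
  (hquad : forall k (S : set T), <<s gens (others k) >> S ->
     \int[P]_(w in S) (X k w ^+ 2)
     = \int[P]_(w in S) (A * (X (k - 1) w ^+ 2 + X (k + 1) w ^+ 2)
                  + B * (X (k - 1) w) * (X (k + 1) w) + C))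
  (AB : A * (1 + r ^+ 4) + B * r ^+ 2 = r ^+ 2)
  (A_lt : A * (1 + r ^+ 2) < 1).

Lemma quad_test s k g (F0 F1 F2 F02 : T -> R) :
  direction s -> adapted (others k) g ->
  L1 g -> L1 F0 -> L1 F1 -> L1 F2 -> L1 F02 ->
  (forall w, F0 w = X (k - s) w ^+ 2 * g w) ->
  (forall w, F1 w = X k w ^+ 2 * g w) ->
  (forall w, F2 w = X (k + s) w ^+ 2 * g w) ->
  (forall w, F02 w = X (k - s) w * X (k + s) w * g w) ->
  \int[P]_w F1 w = A * (\int[P]_w F0 w + \int[P]_w F2 w)
                   + B * (\int[P]_w F02 w) + C * (\int[P]_w g w).
Proof.
move=> ds ag Ig I0 I1 I2 I02 /funext E0 /funext E1 /funext E2 /funext E02.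
subst F0 F1 F2 F02.
have IW : L1 (fun w => A * (X (k - 1) w ^+ 2 + X (k + 1) w ^+ 2)
                  + B * (X (k - 1) w) * (X (k + 1) w) + C).
  have [|//] := L1_lincomb4 P A A B C (fun w =>
    A * (X (k - 1) w ^+ 2 + X (k + 1) w ^+ 2)
    + B * (X (k - 1) w) * (X (k + 1) w) + C)
    (X2 (k - 1)) (X2 (k + 1)) (XX_L1 (k - 1) (k + 1)) (L1_cst P 1).
  by move=> w; ring.
have [|IWg EWg] := L1_lincomb4 P A A B C
  (fun w => (A * (X (k - 1) w ^+ 2 + X (k + 1) w ^+ 2)
                  + B * (X (k - 1) w) * (X (k + 1) w) + C) * g w) I0 I2 I02 Ig.
  by case: ds => -> w; rewrite ?opprK; ring.
rewrite (eq_Rintegral_test_function P (@gens_measurable _ _ _ _ X _) _ _ _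
  (X2 k) IW (hquad k) ag I1 IWg) EWg.
by ring.
Qed.

(** The constant C is found by taking expectations in the quadratic
regression. *)
Lemma C_eq : C = (1 - r ^+ 2) * (1 - A * (1 + r ^+ 2)).
Proof.
have := @quad_test 1 1 (fun=> 1) (fun w => X 0 w ^+ 2) (fun w => X 1 w ^+ 2)
  (fun w => X 2 w ^+ 2) (fun w => X 2 w * X 0 w).
rewrite !EX2 Rintegral_prob_cst.
rewrite cov02 => H.
have {H} := H (or_introl erefl) _ (L1_cst P 1) (X2 0) (X2 1) (X2 2) (XX_L1 2 0).
have aone : adapted (others 1) (fun=> 1) by exact: measurable_cst.
move=> /(_ aone) H; have {H} : 1 = A * (1 + 1) + B * r ^+ 2 + C * 1.
  by apply: H => w; rewrite ?mulr1 // mulrC.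
move: AB; nra.
Qed.

Definition norm_bounded (g : T -> R) := exists K : R, forall w, `|g w| <= K.

Lemma XXbounded j k g : measurable_fun setT g -> norm_bounded g ->
  L1 (fun w => X j w * X k w * g w).
Proof. by move=> mg [K gK]; exact: L1_mul_bounded (XX_L1 j k) mg gK. Qed.

(** Let u_i = E(X_{k+is}^2 g).  The one-sided regressions evaluate
E(X_{k+s} X_{k+2s} g) = r u_1 and E(X_k X_{k+2s} g) = r^2 u_0, and the two-sided
ones at k + s then give two linear equations for u_0, u_1, u_2. *)
Lemma sq_regression_bounded s k g : direction s -> adapted (behind s k) g ->
  norm_bounded g ->
  \int[P]_w (X (k + s) w ^+ 2 * g w)
  = r ^+ 2 * (\int[P]_w (X k w ^+ 2 * g w)) + (1 - r ^+ 2) * (\int[P]_w g w).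
Proof.
move=> ds ag bg; have mg := adapted_measurable X ag.
have I i j := XXbounded i j _ mg bg.
have Ig : L1 g.
  have [K gK] := bg; have := L1_mul_bounded P K (L1_cst P 1) mg gK.
  by have -> : (fun w => 1 * g w) = g by apply/funext => w; rewrite mul1r.
have ag1 : adapted (behind s (k + s)) g.
  exact: (adapted_sub X _ _ _ (behind_step s k ds) ag).
have ago : adapted (others (k + s)) g.
  have := adapted_sub X _ _ _ (behind_others s k 0 ds) ag.
  by rewrite mulr1.
have aX1 : adapted (behind s (k + s)) (X (k + s)).
  by apply: adapted_X; rewrite /behind /=.
have aX0 : adapted (behind s (k + s)) (X k).
  by apply: adapted_X; apply: (behind_step s k ds); rewrite /behind /=.
have aXk : adapted (behind s k) (X k) by apply: adapted_X; rewrite /behind /=.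
have aX2 : adapted (others (k + s)) (X (k + s + s)).
  by apply: adapted_X; rewrite /others /=; case: ds => ->; lia.
have ks : k + s - s = k by rewrite addrK.
have E12 := regression s (k + s) _ _ _ ds (adaptedM X _ _ _ aX1 ag1)
  (I (k + s) (k + s)) (I (k + s + s) (k + s))
  (fun w => esym (mulrA _ _ _)) (fun w => esym (mulrA _ _ _)).
have E02 := regression s (k + s) _ _ _ ds (adaptedM X _ _ _ aX0 ag1)
  (I (k + s) k) (I (k + s + s) k)
  (fun w => esym (mulrA _ _ _)) (fun w => esym (mulrA _ _ _)).
have E01 := regression s k _ _ _ ds (adaptedM X _ _ _ aXk ag)
  (I k k) (I (k + s) k)
  (fun w => esym (mulrA _ _ _)) (fun w => esym (mulrA _ _ _)).
have L12 := lin_test s (k + s) (fun w => X (k + s + s) w * g w)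
  (fun w => X (k + s + s) w * X k w * g w)
  (fun w => X (k + s + s) w * X (k + s) w * g w)
  (fun w => X (k + s + s) w * X (k + s + s) w * g w)
  ds (adaptedM X _ _ _ aX2 ago) (I _ _) (I _ _) (I _ _)
  (fun w => ltac:(cbv beta; rewrite ks; ring))
  (fun w => ltac:(cbv beta; ring)) (fun w => ltac:(cbv beta; ring)).
have Q := quad_test s (k + s) g
  (fun w => X k w * X k w * g w)
  (fun w => X (k + s) w * X (k + s) w * g w)
  (fun w => X (k + s + s) w * X (k + s + s) w * g w)
  (fun w => X (k + s + s) w * X k w * g w)
  ds ago Ig (I _ _) (I _ _) (I _ _) (I _ _)
  (fun w => ltac:(cbv beta; rewrite ks; ring))
  (fun w => ltac:(cbv beta; ring)) (fun w => ltac:(cbv beta; ring))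
  (fun w => ltac:(cbv beta; rewrite ks; ring)).
have -> : (fun w => X (k + s) w ^+ 2 * g w)
    = (fun w => X (k + s) w * X (k + s) w * g w).
  by apply/funext => w; rewrite expr2.
have -> : (fun w => X k w ^+ 2 * g w) = (fun w => X k w * X k w * g w).
  by apply/funext => w; rewrite expr2.
move: E12 E02 E01 L12 Q.
move: (\int[P]_w (X k w * X k w * g w))
  (\int[P]_w (X (k + s) w * X (k + s) w * g w))
  (\int[P]_w (X (k + s + s) w * X (k + s + s) w * g w))
  (\int[P]_w (X (k + s + s) w * X (k + s) w * g w))
  (\int[P]_w (X (k + s + s) w * X k w * g w))
  (\int[P]_w (X (k + s) w * X k w * g w)) (\int[P]_w g w)
  => u0 u1 u2 v12 v02 v01 m -> -> -> L12 Q.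
(* the two evaluations of E(X_{k+s} X_{k+2s} g) *)
have u2E : u2 = (1 + r ^+ 2) * u1 - r ^+ 2 * u0.
  apply: (mulfI r_neq0).
  have /(congr1 ( *%R^~ (1 + r ^+ 2))) := L12.
  rewrite [RHS]mulrAC a_eq => H.
  by apply/eqP; rewrite -subr_eq0; apply/eqP; move: H; nra.
have key : (1 - A * (1 + r ^+ 2)) * (u1 - (r ^+ 2 * u0 + (1 - r ^+ 2) * m)) = 0.
  move: Q; rewrite C_eq u2E => Q.
  have : u0 * (A * (1 + r ^+ 4) + B * r ^+ 2) = u0 * r ^+ 2 by rewrite AB.
  move: Q; nra.
move/eqP: key; rewrite mulf_eq0 !subr_eq0 => /orP[/eqP A1|/eqP //].
by move: A_lt; rewrite -A1 ltxx.
Qed.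

(** That is, E(X_{k+s}^2 | X_j, j behind k) = r^2 X_k^2 + 1 - r^2: the bounded
case applied to indicators, then extended to unbounded test functions. *)
Lemma sq_regression s k g (F0 F1 : T -> R) :
  direction s -> adapted (behind s k) g ->
  L1 g -> L1 F0 -> L1 F1 ->
  (forall w, F0 w = X k w ^+ 2 * g w) ->
  (forall w, F1 w = X (k + s) w ^+ 2 * g w) ->
  \int[P]_w F1 w
  = r ^+ 2 * (\int[P]_w F0 w) + (1 - r ^+ 2) * (\int[P]_w g w).
Proof.
move=> ds ag Ig I0 I1 /funext E0 /funext E1; subst F0 F1.
have [|IW _] := L1_lincomb2 P (r ^+ 2) (1 - r ^+ 2)
  (fun w => r ^+ 2 * X k w ^+ 2 + (1 - r ^+ 2)) (X2 k) (L1_cst P 1).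
  by move=> w; rewrite mulr1.
have [|IWg EWg] := L1_lincomb2 P (r ^+ 2) (1 - r ^+ 2)
  (fun w => (r ^+ 2 * X k w ^+ 2 + (1 - r ^+ 2)) * g w) I0 Ig.
  by move=> w; ring.
rewrite -EWg.
apply: (eq_Rintegral_test_function P (@gens_measurable _ _ _ _ X _) _ _ _
  (X2 (k + s)) IW _ ag I1 IWg).
move=> S GS.
have aS := adapted_indic X _ _ GS.
have mS := adapted_measurable X aS.
have bS : norm_bounded (\1_S : T -> R).
  by exists 1 => w; rewrite indicE; case: (_ \in _); rewrite /= ?normr1 ?normr0.
have [K SK] := bS.
rewrite (Rintegral_indic P _ S) [RHS](Rintegral_indic P _ S).
rewrite sq_regression_bounded//.
have I0S := L1_mul_bounded P K (X2 k) mS SK.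
have IS := L1_mul_bounded P K (L1_cst P 1) mS SK.
have [|_ ->] := L1_lincomb2 P (r ^+ 2) (1 - r ^+ 2)
  (fun w => (r ^+ 2 * X k w ^+ 2 + (1 - r ^+ 2)) * \1_S w) I0S IS.
  by move=> w; ring.
congr (_ + _ * _); congr Rintegral; apply/funext => w; by rewrite mul1r.
Qed.

(** * Integrability of the fourth powers *)

(** The conditional variance of X_{k+s} given the variables behind k is the
constant 1 - r^2. *)
Lemma residual_sq s k g :
  direction s -> adapted (behind s k) g -> norm_bounded g ->
  L1 (fun w => (X (k + s) w - r * X k w) ^+ 2 * g w) /\
  \int[P]_w ((X (k + s) w - r * X k w) ^+ 2 * g w)
  = (1 - r ^+ 2) * \int[P]_w g w.
Proof.
move=> ds ag bg; have mg := adapted_measurable X ag.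
have I i j := XXbounded i j _ mg bg.
have Ig : L1 g.
  have [K gK] := bg; have := L1_mul_bounded P K (L1_cst P 1) mg gK.
  by have -> : (fun w => 1 * g w) = g by apply/funext => w; rewrite mul1r.
have aXk : adapted (behind s k) (X k) by apply: adapted_X; rewrite /behind /=.
have E01 := regression s k _ _ _ ds (adaptedM X _ _ _ aXk ag)
  (I k k) (I (k + s) k)
  (fun w => esym (mulrA _ _ _)) (fun w => esym (mulrA _ _ _)).
have E11 := sq_regression s k _ _ _ ds ag Ig (I k k) (I (k + s) (k + s))
  (fun w => ltac:(cbv beta; ring)) (fun w => ltac:(cbv beta; ring)).
have [|J E] := L1_lincomb4 P 1 (- (2 * r)) (r ^+ 2) 0
  (fun w => (X (k + s) w - r * X k w) ^+ 2 * g w)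
  (I (k + s) (k + s)) (I (k + s) k) (I k k) Ig.
  by move=> w; ring.
by split=> //; rewrite E E01 E11; ring.
Qed.

Lemma trunc_sq_bounded n k : norm_bounded (fun w => trunc_sq n (X k w)).
Proof.
exists n%:R => w.
by rewrite ger0_norm ?trunc_sq_ge0// /trunc_sq ge_min lexx orbT.
Qed.

Lemma adapted_trunc_sq (J : set int) n k : J k ->
  adapted J (fun w => trunc_sq n (X k w)).
Proof.
move=> Jk; apply: measurable_minr; last exact: measurable_cst.
by apply: measurable_funX; exact: adapted_X.
Qed.

(** The bound does not depend on n, because E trunc_sq n (X_j) <= E X_j^2 = 1
after the residuals have been integrated out. *)
Lemma truncated_fourth_moment_le n k :
  r ^+ 2 * (1 - r ^+ 2) ^+ 2
  * (\int[P]_w (X k w * X k w * trunc_sq n (X k w))) <= 16.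
Proof.
have dir1 : direction 1 by left.
have dirN : direction (-1) by right.
have bh s j : behind s j j by rewrite /behind /=.
have [I0 E0] := residual_sq 1 k _ dir1
  (adapted_trunc_sq _ n k (bh 1 k)) (trunc_sq_bounded n k).
have [I1 E1] := residual_sq (-1) (k + 1) _ dirN
  (adapted_trunc_sq _ n (k + 1) (bh (-1) (k + 1))) (trunc_sq_bounded n (k + 1)).
have kE : k + 1 - 1 = k by rewrite addrK.
rewrite kE in I1 E1.
have mt j : measurable_fun setT (fun w => trunc_sq n (X j w)).
  exact: (adapted_measurable X (adapted_trunc_sq _ n j (bh 1 j))).
have I := XXbounded k k _ (mt k) (trunc_sq_bounded n k).
have Et j : \int[P]_w trunc_sq n (X j w) <= 1.
  rewrite -(EX2 j); apply: le_Rintegral => //.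
    apply: (L1_dominated P _ (mt j) (X2 j)) => w.
    by rewrite ger0_norm ?trunc_sq_ge0// /trunc_sq ge_min lexx.
  by move=> w _; rewrite /trunc_sq ge_min lexx.
have [|J E] := L1_lincomb2 P 8 8 (fun w =>
  8 * ((X (k + 1) w - r * X k w) ^+ 2 * trunc_sq n (X k w)) +
  8 * ((X k w - r * X (k + 1) w) ^+ 2 * trunc_sq n (X (k + 1) w))) I0 I1.
  by [].
rewrite -RintegralZl//.
have := le_Rintegral measurableT
  (integrableZl measurableT (r ^+ 2 * (1 - r ^+ 2) ^+ 2) I) J
  (fun w _ => trunc_sq_step r n (X k w) (X (k + 1) w) r_lt1).
rewrite E E0 E1 => /le_trans; apply.
have := Et k; have := Et (k + 1); have := sqr_ge0 r; have := r_lt1.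
by nra.
Qed.

Lemma X4_L1 k : L1 (fun w => X k w ^+ 4).
Proof.
pose D := r ^+ 2 * (1 - r ^+ 2) ^+ 2.
have D0 : 0 < D.
  by rewrite mulr_gt0// exprn_even_gt0//= subr_eq0 gt_eqF// r_lt1.
pose f n w := (X k w * X k w * trunc_sq n (X k w))%:E.
have bh s j : behind s j j by rewrite /behind /=.
have mt n : measurable_fun setT (fun w => trunc_sq n (X k w)).
  exact: (adapted_measurable X (adapted_trunc_sq _ n k (bh 1 k))).
have If n : P.-integrable setT (f n).
  exact: (XXbounded k k _ (mt n) (trunc_sq_bounded n k)).
have f0 n w : setT w -> (0 <= f n w)%E.
  by move=> _; rewrite lee_fin mulr_ge0 ?trunc_sq_ge0// -expr2 sqr_ge0.
have nd w : setT w -> {homo f^~ w : n m / (n <= m)%N >-> (n <= m)%E}.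
  move=> _ n m nm; rewrite lee_fin ler_wpM2l// -?expr2 ?sqr_ge0//.
  by rewrite /trunc_sq le_min !ge_min lexx/= ler_nat nm orbT.
(* the sequence is constant once n >= X_k^2 *)
have flim w : (X k w ^+ 4)%:E = limn (f^~ w).
  apply/esym/lim_near_cst => //.
  have := @nbhs_infty_ger R (X k w ^+ 2).
  apply: filterS => n /= xn; rewrite /f /trunc_sq min_l//.
  by congr EFin; ring.
apply/integrableP; split.
  by apply/measurable_EFinP; exact: measurable_funX.
have -> : (\int[P]_w `|(EFin \o (fun w => (X k w ^+ 4)%R)) w|
    = \int[P]_w limn (f^~ w))%E.
  apply: eq_integral => w _; rewrite -flim /= ger0_norm//.
  by rewrite (exprM _ 2 2) sqr_ge0.
rewrite monotone_convergence// => [|n]; last exact: measurable_int (If n).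
apply: (@le_lt_trans _ _ (16 / D)%:E); last exact: ltry.
apply: lime_le.
  apply: ereal_nondecreasing_is_cvgn => n m nm; apply: ge0_le_integral => //.
  - by move=> w _; exact: f0.
  - exact: measurable_int (If n).
  - exact: measurable_int (If m).
  - by move=> w _; exact: nd.
apply: nearW => n.
have <- : (\int[P]_w (X k w * X k w * trunc_sq n (X k w)))%R%:E
    = (\int[P]_w f n w)%E.
  by rewrite /Rintegral fineK//; exact: (integrable_fin_num measurableT (If n)).
by rewrite lee_fin ler_pdivlMr// mulrC; exact: truncated_fourth_moment_le.
Qed.

Lemma XXXX_L1 i j k l : L1 (fun w => X i w * X j w * X k w * X l w).
Proof.
have [|I _] := L1_lincomb4 P 1 1 1 1
  (fun w => X i w ^+ 4 + X j w ^+ 4 + X k w ^+ 4 + X l w ^+ 4)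
  (X4_L1 i) (X4_L1 j) (X4_L1 k) (X4_L1 l).
  by move=> w; rewrite !mul1r.
apply: (L1_dominated P _ _ I) => [|w].
  by do !apply: measurable_funM.
move: (X i w) (X j w) (X k w) (X l w) => x y z t.
have := sqr_ge0 (x * y - z * t); have := sqr_ge0 (x * y + z * t).
have := sqr_ge0 (x ^+ 2 - y ^+ 2); have := sqr_ge0 (z ^+ 2 - t ^+ 2).
have := sqr_ge0 (x ^+ 2); have := sqr_ge0 (y ^+ 2).
have := sqr_ge0 (z ^+ 2); have := sqr_ge0 (t ^+ 2).
by move=> *; rewrite ler_norml; apply/andP; split; lra.
Qed.

Local Notation E4 i j k l := (\int[P]_w (X i w * X j w * X k w * X l w)).

(** Computing E(X_k^2 X_{k+1}^2) by the quadratic regression forward from k and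
backward from k + 1 gives r^2 E X_k^4 + 1 - r^2 and
r^2 E X_{k+1}^4 + 1 - r^2, so consecutive fourth moments agree. *)
Lemma E4_succ k : E4 k k k k = E4 (k + 1) (k + 1) (k + 1) (k + 1).
Proof.
have bh s j : behind s j j by rewrite /behind /=.
have aX s j : adapted (behind s j) (fun w => X j w * X j w).
  by apply: adaptedM; exact: adapted_X.
have H1 := sq_regression 1 k _ (fun w => X k w * X k w * X k w * X k w)
  (fun w => X (k + 1) w * X (k + 1) w * X k w * X k w)
  (or_introl erefl) (aX 1 k) (XX_L1 k k) (XXXX_L1 _ _ _ _) (XXXX_L1 _ _ _ _)
  (fun w => ltac:(cbv beta; ring)) (fun w => ltac:(cbv beta; ring)).
have kE : k + 1 - 1 = k by rewrite addrK.
have H2 := sq_regression (-1) (k + 1) _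
  (fun w => X (k + 1) w * X (k + 1) w * X (k + 1) w * X (k + 1) w)
  (fun w => X (k + 1) w * X (k + 1) w * X k w * X k w)
  (or_intror erefl) (aX (-1) (k + 1)) (XX_L1 (k + 1) (k + 1))
  (XXXX_L1 _ _ _ _) (XXXX_L1 _ _ _ _)
  (fun w => ltac:(cbv beta; ring)) (fun w => ltac:(cbv beta; rewrite kE; ring)).
have m2 j : \int[P]_w (X j w * X j w) = 1.
  by rewrite -(EX2 j); congr Rintegral; apply/funext => w; rewrite expr2.
move: H1; rewrite H2 !m2 => /addIr /mulfI -> //.
by rewrite expf_neq0.
Qed.

Context (A_gt : r ^+ 2 < A * (1 + r ^+ 4)).

(** The moment E(X_0 X_1^2 X_2) is computed by one-sided regressions (H1, H2)
and by the two-sided quadratic regression at the middle variable (H9), whose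
terms the other equations reduce to M = E X_1^4. *)
Lemma no_intermediate_coefficient : False.
Proof.
have d1 : direction 1 by left.
have dN : direction (-1) by right.
have aX (J : set int) i j : J i -> J j -> adapted J (fun w => X i w * X j w).
  by move=> Ji Jj; apply: adaptedM; exact: adapted_X.
have aX3 (J : set int) i j k : J i -> J j -> J k ->
    adapted J (fun w => X i w * X j w * X k w).
  by move=> Ji Jj Jk; apply: adaptedM; [exact: aX|exact: adapted_X].
have H1 : E4 2 1 1 0 = r * E4 1 1 1 0.
  by apply: (regression 1 1 (fun w => X 1 w * X 1 w * X 0 w)) => //;
    [exact: aX3|exact: XXXX_L1|exact: XXXX_L1|move=> w; ring|move=> w; ring].
have H2 : E4 1 1 1 0 = r * E4 1 1 1 1.
  by apply: (regression (-1) 1 (fun w => X 1 w * X 1 w * X 1 w)) => //;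
    [exact: aX3|exact: XXXX_L1|exact: XXXX_L1|move=> w; ring
    |move=> w; rewrite subrr; ring].
have H3 : E4 2 0 0 0 = r * E4 1 0 0 0.
  by apply: (regression 1 1 (fun w => X 0 w * X 0 w * X 0 w)) => //;
    [exact: aX3|exact: XXXX_L1|exact: XXXX_L1|move=> w; ring|move=> w; ring].
have H4 : E4 1 0 0 0 = r * E4 0 0 0 0.
  by apply: (regression 1 0 (fun w => X 0 w * X 0 w * X 0 w)) => //;
    [exact: aX3|exact: XXXX_L1|exact: XXXX_L1|move=> w; ring|move=> w; ring].
have H5 : E4 0 2 2 2 = r * E4 1 2 2 2.
  by apply: (regression (-1) 1 (fun w => X 2 w * X 2 w * X 2 w)) => //;
    [exact: aX3|exact: XXXX_L1|exact: XXXX_L1|move=> w; ring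
    |move=> w; rewrite subrr; ring].
have H6 : E4 1 2 2 2 = r * E4 2 2 2 2.
  by apply: (regression (-1) 2 (fun w => X 2 w * X 2 w * X 2 w)) => //;
    [exact: aX3|exact: XXXX_L1|exact: XXXX_L1|move=> w; ring
    |move=> w; rewrite (_ : 2 - 1 = 1 :> int)//; ring].
have m2 j : \int[P]_w (X j w * X j w) = 1.
  by rewrite -(EX2 j); congr Rintegral; apply/funext => w; rewrite expr2.
have H7 : E4 2 2 0 0 = r ^+ 2 * E4 1 1 0 0 + (1 - r ^+ 2) * 1.
  rewrite -[X in _ = _ + _ * X](m2 0).
  by apply: (sq_regression 1 1 (fun w => X 0 w * X 0 w)) => //;
    [exact: aX|exact: XX_L1|exact: XXXX_L1|exact: XXXX_L1
    |move=> w; ring|move=> w; ring].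
have H8 : E4 1 1 0 0 = r ^+ 2 * E4 0 0 0 0 + (1 - r ^+ 2) * 1.
  rewrite -[X in _ = _ + _ * X](m2 0).
  by apply: (sq_regression 1 0 (fun w => X 0 w * X 0 w)) => //;
    [exact: aX|exact: XX_L1|exact: XXXX_L1|exact: XXXX_L1
    |move=> w; ring|move=> w; ring].
have H9 : E4 2 1 1 0
    = A * (E4 2 0 0 0 + E4 0 2 2 2) + B * E4 2 2 0 0 + C * r ^+ 2.
  rewrite -cov02.
  by apply: (quad_test 1 1 (fun w => X 2 w * X 0 w)) => //;
    [exact: aX|exact: XX_L1
    |exact: XXXX_L1|exact: XXXX_L1|exact: XXXX_L1|exact: XXXX_L1
    |move=> w; rewrite subrr; ring|move=> w; ring|move=> w; ring
    |move=> w; rewrite subrr; ring].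
have H10 : 1 <= E4 1 1 1 1.
  have [|_ E] := L1_lincomb4 P 1 (-2) 1 0 (fun w => (X 1 w * X 1 w - 1) ^+ 2)
    (XXXX_L1 1 1 1 1) (XX_L1 1 1) (L1_cst P 1) (L1_cst P 1).
    by move=> w; ring.
  have : 0 <= \int[P]_w ((X 1 w * X 1 w - 1) ^+ 2).
    by apply: Rintegral_ge0 => w _; exact: sqr_ge0.
  by rewrite E m2 !Rintegral_prob_cst; lra.
have M01 : E4 0 0 0 0 = E4 1 1 1 1 := E4_succ 0.
have M12 : E4 1 1 1 1 = E4 2 2 2 2 := E4_succ 1.
move: H9; rewrite H1 H2 H3 H4 H5 H6 H7 H8 -M12 M01 C_eq.
move: H10; move: (E4 1 1 1 1) => M M1 H.
have r2 : 0 < r ^+ 2 by rewrite exprn_even_gt0.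
have Bneg : B < 0.
  by rewrite -(pmulr_llt0 _ r2); move: AB A_gt; lra.
have CE : (1 - r ^+ 2) * (1 - A * (1 + r ^+ 2)) = 1 - 2 * A - B * r ^+ 2.
  by move: AB; lra.
have key : r ^+ 2 * (1 - 2 * A - B * r ^+ 2) * (M - 1) = B * (1 - r ^+ 4).
  by move: H; rewrite CE; lra.
have : B * (1 - r ^+ 4) < 0.
  by rewrite nmulr_rlt0// subr_gt0 (exprM _ 2 2) expr_lt1 ?r_lt1// ltW.
rewrite -key -CE ltNge mulr_ge0 ?subr_ge0// mulr_ge0 ?(ltW r2)//.
by rewrite mulr_ge0// subr_ge0 ltW// r_lt1.
Qed.

End two_sided_regressions.

(** * The forbidden interval *)

Lemma cond_expectation_integral {d} {T : measurableType d} {R : realType}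
    (P : probability T R) (F : set_system T) (Y W : T -> R) :
  F `<=` measurable -> measurable_fun setT W ->
  cond_expectation_ae_eq P F Y W ->
  forall S, F S -> \int[P]_(w in S) Y w = \int[P]_(w in S) W w.
Proof.
move=> Fm mW [Z [[_ iZ ZY] ZW]] S FS; have mS := Fm _ FS.
rewrite /Rintegral -ZY//; congr fine; apply: ae_eq_integral => //.
- by apply/measurable_EFinP/measurable_funTS; exact: (L1_measurable P iZ).
- by apply/measurable_EFinP/measurable_funTS.
- by apply: filterS ZW => w -> _.
Qed.

Theorem theorem2p2 (d : measure_display) (T : measurableType d) (R : realType)
    (P : probability T R) (X : int -> {RV P >-> R})
    (r_ : int -> R) (r a b A B C D : R)
    (hstat : strictly_stationary X)
    (hL2 : forall k : int, (X k : T -> R) \in Lfun P 2%:E)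
    (hmean : forall k : int, ('E_P[X k] = 0%:E)%E)
    (hvar : forall k : int, ('E_P[fun w => (X k w ^+ 2)%R] = 1%:E)%E)
    (hcov : forall k : int, ('E_P[fun w => (X 0%R w * X k w)%R] = (r_ k)%:E)%E)
    (hr : r = r_ 1)
    (hr0 : r != 0)
    (hr2 : 2 * `|r| < 1 + r_ 2)
    (hlin : forall k : int,
      cond_expectation_ae_eq P (sigma_others X k) (X k)
        (fun w => a * (X (k - 1) w + X (k + 1) w) + b))
    (hquad : forall k : int,
      cond_expectation_ae_eq P (sigma_others X k) (fun w => X k w ^+ 2)
        (fun w => A * (X (k - 1) w ^+ 2 + X (k + 1) w ^+ 2)
                  + B * (X (k - 1) w) * (X (k + 1) w)
                  + C + D * (X (k - 1) w + X (k + 1) w)))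
    (hD : D = 0)
    (hAB : A * (r ^+ 2 + 1 / r ^+ 2) + B = 1) :
  A >= 1 / (1 + r ^+ 2) \/ A <= r ^+ 2 / (1 + r ^+ 4).
Proof.
have [|A_hi] := leP (1 / (1 + r ^+ 2)) A; first by left.
have [|A_lo] := leP A (r ^+ 2 / (1 + r ^+ 4)); first by right.
have r2 : 0 < r ^+ 2 by rewrite exprn_even_gt0.
have r4 : 0 < 1 + r ^+ 4 by rewrite ltr_pwDl// (exprM _ 2 2) sqr_ge0.
have A_lt : A * (1 + r ^+ 2) < 1.
  by rewrite -ltr_pdivlMr// ltr_wpDr// ltW.
have A_gt : r ^+ 2 < A * (1 + r ^+ 4) by rewrite -ltr_pdivrMr.
have AB : A * (1 + r ^+ 4) + B * r ^+ 2 = r ^+ 2.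
  have -> : A * (1 + r ^+ 4) + B * r ^+ 2
      = (A * (r ^+ 2 + 1 / r ^+ 2) + B) * r ^+ 2 by field.
  by rewrite hAB mul1r.
have cov k : \int[P]_w (X k w * X 0 w) = r_ k.
  have -> : (fun w => X k w * X 0 w) = (fun w => X 0 w * X k w).
    by apply/funext => w; rewrite mulrC.
  by have := hcov k; rewrite unlock /Rintegral => ->.
exfalso; apply: (no_intermediate_coefficient X r a b _ _ _ _ _ _
  A B C hr0 _ AB A_lt A_gt).
- by move=> k; exact: Lfun2_integrable_sqr.
- by move=> k; have := hmean k; rewrite unlock /Rintegral => ->.
- by move=> k; have := hvar k; rewrite unlock /Rintegral => ->.
- by rewrite cov.
- by rewrite cov.
- move=> k; apply: cond_expectation_integral (hlin k).
    by move=> S; exact: (gen_measurable (gens_measurable X _)).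
  by apply: measurable_funD => //; apply: measurable_funM => //;
    exact: measurable_funD.
- move=> k; apply: cond_expectation_integral.
  + by move=> S; exact: (gen_measurable (gens_measurable X _)).
  + apply: measurable_funD => //.
    apply: measurable_funD; apply: measurable_funM => //.
    * by apply: measurable_funD; exact: measurable_funX.
    * exact: measurable_funM.
  + have -> : (fun w => A * (X (k - 1) w ^+ 2 + X (k + 1) w ^+ 2)
        + B * X (k - 1) w * X (k + 1) w + C)
      = (fun w => A * (X (k - 1) w ^+ 2 + X (k + 1) w ^+ 2)
        + B * X (k - 1) w * X (k + 1) w + C + D * (X (k - 1) w + X (k + 1) w)).
      by apply/funext => w; rewrite hD; ring.
    exact: hquad.
Qed.
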